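(* For every $a\in(-\infty,1)$, the map $R_a:\mathbb D_a\to\mathbb D_a$ is continuous with respect to the norm $\|\rho\,\cdot\|_{L^\infty}$.
   Context: Let $\rho(x)=(1+|x|)^{-1/2}$ and $\eta_a=\frac{1}{2^{9/2}(4+|a|)^3}$. $\mathbb D_a$ is the set of continuous even functions $\omega$ on $\mathbb R$ with $\|\rho\omega\|_{L^\infty}<\infty$ such that $\omega(0)=1$; $(1-x^2)_+\le\omega(x)\le1$ for all $x$; $\omega$ is non-increasing on $[0,\infty)$; $s\mapsto\omega(\sqrt s)$ is convex on $[0,\infty)$; and the left derivative satisfies $\omega'_-(1/2)\le-\eta_a$. $T(\omega)(x)=\frac1\pi\int_0^\infty\ln\left|\frac{x^2-y^2}{y^2}\right|\omega(y)\,dy$, $r(\omega)=\frac1\pi\int_0^\infty\frac{\omega(0)-\omega(y)}{y^2}\,dy$. For $a\ne0$, $R_a(\omega)(x)=\big(1-\frac{aT(\omega)(x)}{r(\omega)}\big)_+^{1/a}$; for $a=0$, $R_0(\omega)(x)=\exp\big(-\frac{T(\omega)(x)}{r(\omega)}\big)$. That $R_a$ maps $\mathbb D_a$ into itself is a separate result. *)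

(* Defs.v *)
From HB Require Import structures.
From mathcomp Require Import all_boot all_order all_algebra.
From mathcomp Require Import all_classical all_reals all_analysis.
Set Implicit Arguments. Unset Strict Implicit. Unset Printing Implicit Defensive.
Import Order.TTheory GRing.Theory Num.Theory.
Import numFieldNormedType.Exports.
Local Open Scope classical_set_scope.
Local Open Scope ring_scope.

Section Defs.
Variable R : realType.

Definition rho (x : R) : R := (1 + `|x|) `^ (- (2^-1)).

Definition eta (a : R) : R := (2 `^ (9 / 2) * (4 + `|a|) ^+ 3)^-1.

(* weighted sup norm || rho f ||_{L^infty} (f continuous, so sup = ess sup) *)
Definition rho_norm (f : R -> R) : R := sup [set `|rho x * f x| | x in setT].

Definition Dset (a : R) : set (R -> R) :=
  [set w : R -> R |
     continuous w
  /\ (forall x, w (- x) = w x)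
  /\ (exists M : R, forall x, `|rho x * w x| <= M)
  /\ w 0 = 1
  /\ (forall x, Num.max (1 - x ^+ 2) 0 <= w x /\ w x <= 1)
  /\ (forall x y, 0 <= x -> x <= y -> w y <= w x)
  /\ (forall s t l, 0 <= s -> 0 <= t -> 0 <= l -> l <= 1 ->
        w (Num.sqrt (l * s + (1 - l) * t))
          <= l * w (Num.sqrt s) + (1 - l) * w (Num.sqrt t))
  /\ (exists l : R,
        (fun h => (w (2^-1 + h) - w (2^-1)) / h) @ 0^'- --> l
        /\ l <= - eta a)].

Definition Top (w : R -> R) (x : R) : R :=
  pi^-1 * Rintegral (@lebesgue_measure R) `[0, +oo[%classic
    (fun y => ln `|(x ^+ 2 - y ^+ 2) / y ^+ 2| * w y).

Definition rfun (w : R -> R) : R :=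
  pi^-1 * Rintegral (@lebesgue_measure R) `[0, +oo[%classic
    (fun y => (w 0 - w y) / y ^+ 2).

Definition Rop (a : R) (w : R -> R) (x : R) : R :=
  if a == 0 then expR (- (Top w x / rfun w))
  else (Num.max (1 - a * Top w x / rfun w) 0) `^ a^-1.

End Defs.

(* Main.v *)
Require Import Defs.
From HB Require Import structures.
From mathcomp Require Import all_boot all_order all_algebra.
From mathcomp Require Import all_classical all_reals all_analysis.
From mathcomp Require Import measurable_realfun ring lra.
Import Order.TTheory GRing.Theory Num.Theory.
Import numFieldNormedType.Exports.
Set Implicit Arguments. Unset Strict Implicit. Unset Printing Implicit Defensive.
Local Open Scope classical_set_scope.
Local Open Scope ring_scope.

(** [R_a(w)] is [F_a(T(w)/r(w))] with [F_a(t) = (1 - a t)_+^(1/a)], and for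
    [a < 1] the function [F_a] maps [t >= 0] into [[0, 1]] and is 1-Lipschitz
    there.  The kernel [ln |(x^2 - y^2) / y^2|] of [T] has the explicit
    primitive [L(y + x) + L(y - x) - 2 L(y)] with [L(u) = u ln |u|]; it follows
    that its integral over [y >= 0] vanishes, that its L1 norm is at most
    [10 |x|], and that its tail beyond [M > |x|] has mass at most
    [2 x^2 / (M - |x|)].  Since the kernel changes sign once, from positive to
    negative, and [w] is non-increasing, [T(w) >= 0], hence [0 <= R_a(w) <= 1]
    and [rho R_a(w)] is uniformly small for large [|x|].  On a bounded range
    of [x] the Lipschitz bound reduces the claim to the closeness of [T] and
    [r], where the integrals are cut at [M]: below [M] the functions are
    uniformly close in the weighted norm, above [M] their distance is at
    most 1. *)

(** * Fundamental theorem of calculus for nonnegative integrands on open and unbounded intervals *)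

Section FTC.
Variable R : realType.
Notation mu := (@lebesgue_measure R).

(** On each compact interval the classical theorem applies, and monotone convergence passes to the
    union. Only limits of [F] along the endpoints are required, so [f] may be singular at the ends
    of the union, as the kernel of [T] is. *)
Lemma ge0_FTC2_exhaustion (f F : R -> R) (u v : R^nat) (lu lv : R) :
  nonincreasing_seq u -> nondecreasing_seq v -> (forall n, u n < v n) ->
  (forall n y, u n <= y <= v n -> 0 <= f y) ->
  (forall n y, u n <= y <= v n -> is_derive y 1 F (f y)) ->
  (forall n y, u n <= y <= v n -> {for y, continuous f}) ->
  F (u n) @[n --> \oo] --> lu -> F (v n) @[n --> \oo] --> lv ->
  (\int[mu]_(y in \bigcup_n `[u n, v n]%classic) (f y)%:E = (lv - lu)%:E)%E.
Proof.
move=> niu ndv uv f0 dF cf Flu Flv.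
have cfn n : {within `[u n, v n], continuous f}.
  apply: continuous_in_subspaceT => y.
  by rewrite inE/= in_itv/= => uyv; exact: cf uyv.
have ndI : nondecreasing_seq (fun n => `[u n, v n]%classic).
  move=> m n mn; rewrite subsetEset => y/=; rewrite !in_itv/= => /andP[uy yv].
  by rewrite (le_trans (niu _ _ mn) uy) (le_trans yv (ndv _ _ mn)).
have cvgI : (\int[mu]_(y in `[u n, v n]) (f y)%:E)%E @[n --> \oo] -->
    (\int[mu]_(y in \bigcup_n `[u n, v n]%classic) (f y)%:E)%E.
  apply: ge0_nondecreasing_set_cvg_integral => // n.
    apply/measurable_EFinP; exact: subspace_continuous_measurable_fun.
apply: (cvg_unique _ cvgI) => //=.
have -> : (fun n => \int[mu]_(y in `[u n, v n]) (f y)%:E)%E =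
    (fun n => (F (v n) - F (u n))%:E).
  apply/funext => n; rewrite (@continuous_FTC2 _ f F)//.
  - have dFn y : u n <= y <= v n -> derivable F y 1.
      by move=> uyv; have [] := dF _ _ uyv.
    have cF : {within `[u n, v n], continuous F}.
      by apply: derivable_within_continuous => y; rewrite in_itv/=; exact: dFn.
    have [_ Fu Fv] := (continuous_within_itvP F (uv n)).1 cF.
    split => // y; rewrite in_itv/= => /andP[uy yv].
    by apply: dFn; rewrite !ltW.
  - move=> y; rewrite in_itv/= => /andP[uy yv].
    rewrite derive1E; have [|_ ->//] := dF n y.
    by rewrite !ltW.
apply: cvg_EFin; first exact: nearW.
exact: cvgB.
Qed.

Lemma ge0_FTC2_oo (f F : R -> R) (a b : R) : a < b ->
  (forall y, a < y < b -> 0 <= f y) ->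
  (forall y, a < y < b -> is_derive y 1 F (f y)) ->
  (forall y, a < y < b -> {for y, continuous f}) ->
  {for a, continuous F} -> {for b, continuous F} ->
  (\int[mu]_(y in `]a, b[) (f y)%:E = (F b - F a)%:E)%E.
Proof.
move=> ab f0 dF cf Fa Fb.
(* The shift by 2 gives [e n <= (b - a) / 3], so [a + e n < b - e n] already at [n = 0]. *)
pose e n : R := (b - a) * harmonic (n + 2)%N.
have ba : 0 < b - a by rewrite subr_gt0.
have e0 n : 0 < e n by rewrite mulr_gt0// harmonic_gt0.
have e2 n : e n + e n < b - a.
  have h3 : @harmonic R (n + 2)%N <= 3^-1.
    by rewrite lef_pV2 ?posrE ?ltr0n// ler_nat addn2.
  rewrite /e; nra.
have nie : nonincreasing_seq e.
  move=> m n mn; rewrite /e ler_pM2l// lef_pV2 ?posrE ?ltr0n//.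
  by rewrite ler_nat ltnS leq_add2r.
have cvge : e n @[n --> \oo] --> (0 : R).
  rewrite -[X in _ --> X](mulr0 (b - a)); apply: cvgM; first exact: cvg_cst.
  apply: (cvg_comp (addn^~ 2) harmonic (cvg_addnr 2)); exact: cvg_harmonic.
have -> : `]a, b[%classic = \bigcup_n `[a + e n, b - e n]%classic.
  apply/seteqP; split=> [y|y [n _]]/=; last first.
    rewrite !in_itv/= => /andP[ay yb]; have := e0 n; lra.
  rewrite in_itv/= => /andP[ay yb].
  have m0 : 0 < Num.min (y - a) (b - y) by rewrite lt_min !subr_gt0 ay.
  have [n _ /(_ n (leqnn n))/=] := (cvgrPdist_lt _ _).1 cvge _ m0.
  rewrite sub0r normrN gtr0_norm// lt_min => /andP[ey1 ey2].
  by exists n => //=; rewrite in_itv/=; lra.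
apply: (@ge0_FTC2_exhaustion f F) => //.
- by move=> m n mn; rewrite lerD2l nie.
- by move=> m n mn; rewrite lerD2l lerN2 nie.
- by move=> n; have := e2 n; lra.
- by move=> n y ?; apply: f0; have := e0 n; lra.
- by move=> n y ?; apply: dF; have := e0 n; lra.
- by move=> n y ?; apply: cf; have := e0 n; lra.
- apply: continuous_cvg => //; rewrite -[X in _ --> X](addr0 a).
  by apply: cvgD => //; exact: cvg_cst.
- apply: continuous_cvg => //; rewrite -[X in _ --> X](subr0 b).
  by apply: cvgB => //; exact: cvg_cst.
Qed.

Lemma ge0_FTC2_oy (f F : R -> R) (a l : R) :
  (forall y, a < y -> 0 <= f y) ->
  (forall y, a < y -> is_derive y 1 F (f y)) ->
  (forall y, a < y -> {for y, continuous f}) ->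
  {for a, continuous F} -> F y @[y --> +oo] --> l ->
  (\int[mu]_(y in `]a, +oo[%classic) (f y)%:E = (l - F a)%:E)%E.
Proof.
move=> f0 dF cf Fa Fl.
pose e n : R := harmonic n.
have e0 n : 0 < e n by exact: harmonic_gt0.
have e1 n : e n <= 1 by rewrite invf_le1 ?ltr0n// ler1n.
have nie : nonincreasing_seq e.
  by move=> m n mn; rewrite /e lef_pV2 ?posrE ?ltr0n// ler_nat ltnS.
have cvge : e n @[n --> \oo] --> (0 : R) by exact: cvg_harmonic.
(* The right endpoints start at [a + 2] because [e 0 = 1]: every interval must have positive
   length. *)
have cvgv : (a + n.+2%:R) @[n --> \oo] --> +oo.
  apply/cvgryPge => A; near=> n.
  rewrite -lerBlDl (@le_trans _ _ n%:R)//; last by rewrite ler_nat -addn2 leq_addr.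
  by near: n; exact: nbhs_infty_ger.
have -> : `]a, +oo[%classic = \bigcup_n `[a + e n, a + n.+2%:R]%classic.
  apply/seteqP; split=> [y|y [n _]]/=; last first.
    rewrite !in_itv/= => /andP[ay yb]; have := e0 n; lra.
  rewrite in_itv/= andbT => ay.
  have ya : 0 < y - a by rewrite subr_gt0.
  have near1 := (cvgrPdist_lt _ _).1 cvge _ ya.
  have near2 := (cvgryPge _).1 cvgv y.
  have [n _ /(_ n (leqnn n))/= [+ yn]] := filterI (near1 _) (near2 _).
  rewrite sub0r normrN gtr0_norm// => ey1.
  by exists n => //=; rewrite in_itv/=; lra.
apply: (@ge0_FTC2_exhaustion f F) => //.
- by move=> m n mn; rewrite lerD2l nie.
- by move=> m n mn; rewrite lerD2l ler_nat !ltnS.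
- by move=> n; rewrite ltrD2l (le_lt_trans (e1 n))// ltr1n.
- by move=> n y ?; apply: f0; have := e0 n; lra.
- by move=> n y ?; apply: dF; have := e0 n; lra.
- by move=> n y ?; apply: cf; have := e0 n; lra.
- apply: continuous_cvg => //; rewrite -[X in _ --> X](addr0 a).
  by apply: cvgD => //; exact: cvg_cst.
- exact: cvg_comp cvgv Fl.
Unshelve. all: by end_near. Qed.

End FTC.

(** * Splitting, comparison and elementary integrals on intervals *)

Section integration.
Variable R : realType.
Notation mu := (@lebesgue_measure R).
Implicit Types (c M : R) (f : R -> R).

Lemma disjoint_itv_at (a b : itv_bound R) c :
  [disjoint [set` Interval a (BLeft c)] & [set` Interval (BLeft c) b]].
Proof.
apply/disj_setPS => y [/=]; rewrite !in_itv/= => /andP[_ yx] /andP[].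
by rewrite leNgt yx.
Qed.

Lemma Rintegral_split_at f (a b : itv_bound R) c :
  mu.-integrable [set` Interval a b] (EFin \o f) ->
  (a <= BLeft c)%O -> (BLeft c <= b)%O ->
  Rintegral mu [set` Interval a b] f =
    Rintegral mu [set` Interval a (BLeft c)] f +
    Rintegral mu [set` Interval (BLeft c) b] f.
Proof.
move=> + ac cb; rewrite (itv_bndbnd_setU ac cb) => fi.
by rewrite Rintegral_setU//; exact: disjoint_itv_at.
Qed.

Lemma ge0_subset_Rintegral f (A B : set R) : measurable A -> measurable B ->
  mu.-integrable B (EFin \o f) -> (forall y, B y -> 0 <= f y) -> A `<=` B ->
  Rintegral mu A f <= Rintegral mu B f.
Proof.
move=> mA mB fi f0 AB; apply: fine_le.
- by apply: integrable_fin_num => //; exact: integrableS fi.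
- exact: integrable_fin_num.
- apply: ge0_subset_integral => //; first exact: measurable_int fi.
Qed.

Lemma Rintegral_cst_itv (a b k : R) : a <= b ->
  Rintegral mu `[a, b[%classic (fun=> k) = k * (b - a).
Proof.
move=> ab; rewrite Rintegral_cst//= lebesgue_measure_itv/= lte_fin.
by case: ltgtP ab => //= -> _; rewrite subrr.
Qed.

Lemma integrable_cst_itv (a b k : R) : mu.-integrable `[a, b[%classic (EFin \o (fun=> k)).
Proof.
apply: measurable_bounded_integrable => //=.
- rewrite lebesgue_measure_itv/= lte_fin; case: ifP => _; exact: ltry.
- by exists `|k|; split; [exact: num_real|move=> e ke y _ /=; exact: ltW].
Qed.

Lemma measurable_inv_sqr : measurable_fun setT (fun y : R => (y ^+ 2)^-1).
Proof.
(* Read as the power -1 of a nonnegative base, the inverse needs no case split at [y = 0]. *)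
have -> : (fun y : R => (y ^+ 2)^-1) = (fun y => powR (y ^+ 2) (-1)).
  by apply/funext => y; rewrite powR_inv1// sqr_ge0.
apply: (measurableT_comp (measurable_powR (-1))).
exact: measurable_funX.
Qed.

Lemma int_inv_sqr M : 0 < M ->
  (\int[mu]_(y in `[M, +oo[%classic) ((y ^+ 2)^-1)%:E = (M^-1)%:E)%E.
Proof.
move=> M0.
rewrite -integral_itv_obnd_cbnd; last first.
  by apply/measurable_EFinP/measurable_funTS; exact: measurable_inv_sqr.
transitivity ((0 - (- M^-1))%:E); last by rewrite sub0r opprK.
apply: (@ge0_FTC2_oy _ _ (fun y => - y^-1)).
- by move=> y _; rewrite invr_ge0 sqr_ge0.
- move=> y My; have y0 : y != 0 by rewrite gt_eqF// (lt_trans M0).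
  have := is_deriveN (is_deriveV y0 (is_derive_id y 1)).
  by move/is_derive_eq; apply; rewrite /GRing.scale/= mulr1 opprK -exprVn.
- move=> y My; have y0 : y != 0 by rewrite gt_eqF// (lt_trans M0).
  apply: cvgV; first by rewrite expf_neq0.
  exact: exprn_continuous.
- apply: cvgN; apply: cvgV; first by rewrite gt_eqF.
  exact: cvg_id.
- rewrite -[X in _ --> X]oppr0; apply: cvgN; apply/gtr0_cvgV0; last exact: cvg_id.
  by apply: nbhs_pinfty_gt; exact: num_real.
Qed.

Lemma integrable_scale f (i : interval R) (k : R) :
  mu.-integrable [set` i] (EFin \o f) ->
  mu.-integrable [set` i] (EFin \o (fun y => k * f y)).
Proof.
by move=> fi; exact: (@integrableZl _ _ _ mu _ (measurable_itv i) k _ fi).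
Qed.

End integration.

(** * The kernel of [T], its sign, and its primitive *)

Section kernel.
Variable R : realType.
Implicit Types x y u p q c : R.

(** Trades the absolute value for a square, so that the chain rule differentiates [ln |u|] for both
    signs of [u] at once. *)
Lemma ln_norm_sqr u : ln `|u| = 2^-1 * ln (u ^+ 2).
Proof.
have [->|u0] := eqVneq u 0; first by rewrite normr0 expr0n/= ln0// mulr0.
rewrite -(real_normK (num_real u)) lnXn ?normr_gt0//; lra.
Qed.

Lemma is_derive_ln_norm u : u != 0 ->
  is_derive u 1 (fun u => ln `|u|) u^-1.
Proof.
move=> u0; have -> : (fun u => ln `|u|) =
    2^-1 \*: (@ln R \o ((@id R) ^+ 2)).
  by apply/funext => v; rewrite ln_norm_sqr.
have u20 : 0 < u ^+ 2 by rewrite exprn_even_gt0.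
have dln : is_derive (((@id R) ^+ 2) u) 1 (@ln R) (u ^+ 2)^-1.
  exact: is_derive1_ln.
have := is_deriveZ 2^-1 (is_derive1_comp dln (is_deriveX 2 (is_derive_id u 1))).
by move/is_derive_eq; apply; rewrite /= /GRing.scale/=; field.
Qed.

(** The function [L] of the overview. Its value 0 at 0 is the continuous one, so [prim] is
    continuous even at the singular points of the kernel. *)
Definition xlnx u := u * ln `|u|.

Lemma is_derive_xlnx u : u != 0 -> is_derive u 1 xlnx (ln `|u| + 1).
Proof.
move=> u0.
have := is_deriveM (is_derive_id u 1) (is_derive_ln_norm u0).
move/is_derive_eq; apply.
by rewrite /GRing.scale/= mulfV// mulr1 addrC.
Qed.

(** A bound vanishing at 0, for continuity there. Large [|u|] uses [ln v < v]; small [|u|] uses the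
    same inequality at [1 / sqrt v], which gives [- ln v < 2 / sqrt v]. At [1 / v] it would yield no
    decay. *)
Lemma xlnx_bound u : `|xlnx u| <= 2 * Num.sqrt `|u| + `|u| ^+ 2.
Proof.
have [->|u0] := eqVneq u 0.
  by rewrite /xlnx mul0r normr0 sqrtr0 mulr0 expr0n add0r.
rewrite /xlnx normrM; set v := `|u|.
have v0 : 0 < v by rewrite normr_gt0.
have s0 : 0 < Num.sqrt v by rewrite sqrtr_gt0.
have vE : v = Num.sqrt v ^+ 2 by rewrite sqr_sqrtr// ltW.
have lnv := ln_sublinear v0.
have lnNv : - ln v < 2 * (Num.sqrt v)^-1.
  have := ln_sublinear (divr_gt0 ltr01 s0).
  rewrite div1r lnV ?posrE// => h.
  by rewrite [in ltLHS]vE lnXn//; lra.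
have h1 : v * (- ln v) <= 2 * Num.sqrt v.
  have -> : 2 * Num.sqrt v = v * (2 * (Num.sqrt v)^-1).
    by move: vE s0; move: (Num.sqrt v) => s -> s0; field; rewrite gt_eqF.
  by rewrite ler_pM2l// ltW.
have h2 : v * ln v <= v ^+ 2 by rewrite expr2 ler_pM2l// ltW.
have v20 : 0 <= v ^+ 2 by rewrite sqr_ge0.
by have [ln0|ln0] := ger0P (ln v); lra.
Qed.

Lemma continuous_xlnx : continuous xlnx.
Proof.
move=> u; have [->|u0] := eqVneq u 0; last first.
  apply/differentiable_continuous/derivable1_diffP.
  by have [] := is_derive_xlnx u0.
rewrite /continuous_at /xlnx mul0r.
have cb : (2 * Num.sqrt `|u| + `|u| ^+ 2) @[u --> (0 : R)] --> (0 : R).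
  have cn : `|u| @[u --> (0 : R)] --> (0 : R).
    by rewrite -[X in _ --> X](@normr0 _ R); exact: norm_continuous.
  rewrite -[X in _ --> X](addr0 (0 : R)); apply: cvgD.
    rewrite -[X in _ --> X](mulr0 (2 : R)).
    apply: cvgM; first exact: cvg_cst.
    rewrite -[X in _ --> X](@sqrtr0 R).
    by apply: continuous_cvg => //; exact: sqrt_continuous.
  by rewrite -[X in _ --> X](mulr0 (0 : R)); apply: cvgM.
apply: (@squeeze_cvgr _ _ _ _ (fun u => - (2 * Num.sqrt `|u| + `|u| ^+ 2)) _ _ _ _ _ cb).
  by near=> v; rewrite -ler_norml; exact: xlnx_bound.
by rewrite -[X in _ --> X]oppr0; exact: cvgN.
Unshelve. all: by end_near. Qed.

(** With the conventions for the inverse of 0 and for [ln 0], the value at the singular points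
    [y = 0] and [y = x], [y = - x] is 0. *)
Definition kern x y := ln `|(x ^+ 2 - y ^+ 2) / y ^+ 2|.

Definition prim x y := xlnx (y + x) + xlnx (y - x) - 2 * xlnx y.

Lemma kernE x y : y != 0 -> y + x != 0 -> y - x != 0 ->
  kern x y = ln `|y + x| + ln `|y - x| - 2 * ln `|y|.
Proof.
move=> y0 yDx yBx; rewrite /kern.
have -> : (x ^+ 2 - y ^+ 2) / y ^+ 2 = - ((y + x) * (y - x) / (y * y)).
  by field.
rewrite normrN !normrM normfV ln_div ?posrE ?mulr_gt0 ?normr_gt0 ?mulf_neq0//.
by rewrite normrM !lnM ?posrE ?normr_gt0//; lra.
Qed.

(** The constants [+ 1] in the three derivatives of [xlnx] cancel. *)
Lemma is_derive_prim x y : y != 0 -> y + x != 0 -> y - x != 0 ->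
  is_derive y 1 (prim x) (kern x y).
Proof.
move=> y0 yDx yBx.
have shift (c : R) : is_derive y 1 (fun y => y + c) 1.
  have := is_deriveD (is_derive_id y 1) (is_derive_cst c y 1).
  by move/is_derive_eq; apply; rewrite addr0.
have := is_deriveB (is_deriveD
  (@is_derive1_comp _ xlnx (+%R^~ x) _ _ _ (is_derive_xlnx yDx) (shift x))
  (@is_derive1_comp _ xlnx (+%R^~ (- x)) _ _ _ (is_derive_xlnx yBx) (shift (- x))))
  (is_deriveZ 2 (is_derive_xlnx y0)).
by move/is_derive_eq; apply; rewrite kernE// /GRing.scale/=; lra.
Qed.

Lemma continuous_prim x : continuous (prim x).
Proof.
move=> y; rewrite /prim; apply: cvgB; first apply: cvgD.
- apply: (@continuous_comp _ _ _ (fun y => y + x) xlnx); last exact: continuous_xlnx.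
  by apply: cvgD; [exact: cvg_id|exact: cvg_cst].
- apply: (@continuous_comp _ _ _ (fun y => y - x) xlnx); last exact: continuous_xlnx.
  by apply: cvgB; [exact: cvg_id|exact: cvg_cst].
- by apply: cvgM; [exact: cvg_cst|exact: continuous_xlnx].
Qed.

Lemma continuous_kern x y : y != 0 -> y + x != 0 -> y - x != 0 ->
  {for y, continuous (kern x)}.
Proof.
move=> y0 yDx yBx.
have lnc u : u != 0 -> {for u, continuous (fun u => ln `|u|)}.
  move=> u0; apply/differentiable_continuous/derivable1_diffP.
  by have [] := is_derive_ln_norm u0.
rewrite /kern.
apply: (@continuous_comp _ _ _ (fun y => (x ^+ 2 - y ^+ 2) / y ^+ 2)
  (fun u => ln `|u|)); last first.
  apply: lnc; rewrite mulf_neq0 ?invr_neq0 ?expf_neq0//.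
  have -> : x ^+ 2 - y ^+ 2 = - ((y + x) * (y - x)) by ring.
  by rewrite oppr_eq0 mulf_neq0.
have cX : {for y, continuous (fun y : R => y ^+ 2)} by exact: exprn_continuous.
apply: cvgM; first by apply: cvgB => //; exact: cvg_cst.
by apply: cvgV => //; rewrite expf_neq0.
Qed.

Lemma measurable_kern x : measurable_fun setT (kern x).
Proof.
have mX : measurable_fun setT (fun y : R => y ^+ 2) by exact: measurable_funX.
apply: (measurableT_comp (@measurable_ln R)).
apply: (measurableT_comp (@normr_measurable R setT)) => //.
apply: measurable_funM; first exact: measurable_funB.
exact: measurable_inv_sqr.
Qed.

(** For [y != 0] the argument of the logarithm is at least 1 as soon as [2 * y ^+ 2 <= x ^+ 2];
    beyond that point it is at most 1, which is the content of [kern_le0]. *)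
Lemma kern_ge0 x y : 2 * y ^+ 2 <= x ^+ 2 -> 0 <= kern x y.
Proof.
have [->|y0] := eqVneq y 0.
  by move=> _; rewrite /kern expr0n/= invr0 mulr0 normr0 ln0.
move=> yx; apply: ln_ge0.
have y20 : 0 < y ^+ 2 by rewrite exprn_even_gt0.
by rewrite (le_trans _ (ler_norm _))// ler_pdivlMr//; lra.
Qed.

Lemma kern_le0 x y : x ^+ 2 <= 2 * y ^+ 2 -> kern x y <= 0.
Proof.
have [->|y0] := eqVneq y 0.
  by move=> _; rewrite /kern expr0n/= invr0 mulr0 normr0 ln0.
move=> xy; apply: ln_le0.
have y20 : 0 < y ^+ 2 by rewrite exprn_even_gt0.
have x20 := sqr_ge0 x.
by rewrite ler_norml ler_pdivlMr// ler_pdivrMr//; lra.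
Qed.

Lemma prim0 x : prim x 0 = 0.
Proof. by rewrite /prim /xlnx !add0r normrN mul0r; ring. Qed.

Lemma primE x y : y != 0 -> y + x != 0 -> y - x != 0 ->
  prim x y = y * kern x y + x * (ln `|y + x| - ln `|y - x|).
Proof. by move=> *; rewrite kernE// /prim /xlnx; ring. Qed.

Lemma ln_ratio_bound p q : 0 < p -> 0 < q -> ln p - ln q <= (p - q) / q.
Proof.
move=> p0 q0; rewrite -ln_div ?posrE//.
have -> : p / q = 1 + (p - q) / q by field; rewrite gt_eqF.
apply: le_ln1Dx; rewrite ltr_pdivlMr//; lra.
Qed.

(** In the form [primE] the first term is nonpositive and the second nonnegative, so it suffices to
    bound each of them by the right-hand side. Both bounds come from
    [ln p - ln q <= (p - q) / q]. *)
Lemma prim_bound x y : 0 <= x -> x < y -> `|prim x y| <= 2 * x ^+ 2 / (y - x).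
Proof.
move=> x0 xy; have yx0 : 0 < y - x by lra.
have yDx0 : 0 < y + x by lra.
have y0 : 0 < y by lra.
rewrite primE ?gt_eqF// (gtr0_norm yDx0) (gtr0_norm yx0).
have h1 := ln_ratio_bound yDx0 yx0.
have h2 : 0 <= ln (y + x) - ln (y - x) by rewrite subr_ge0 ler_ln ?posrE//; lra.
have h3 : x * (ln (y + x) - ln (y - x)) <= 2 * x ^+ 2 / (y - x).
  have -> : 2 * x ^+ 2 / (y - x) = x * ((y + x - (y - x)) / (y - x)).
    by field; rewrite gt_eqF.
  by rewrite ler_wpM2l.
have h4 : y * kern x y <= 0 by rewrite pmulr_rle0// kern_le0//; nra.
have h5 : - (y * kern x y) <= 2 * x ^+ 2 / (y - x).
  rewrite kernE ?gt_eqF// !gtr0_norm//.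
  have h6 := ln_ratio_bound y0 yDx0.
  have h7 := ln_ratio_bound y0 yx0.
  rewrite (@le_trans _ _ (y * ((y - (y + x)) / (y + x) + (y - (y - x)) / (y - x))))//.
    by rewrite -mulrN ler_pM2l//; lra.
  have -> : y * ((y - (y + x)) / (y + x) + (y - (y - x)) / (y - x)) =
      (2 * x ^+ 2 / (y - x)) * (y / (y + x)).
    by field; rewrite !gt_eqF.
  rewrite ler_piMr//; last by rewrite ler_pdivrMr//; lra.
  by rewrite divr_ge0 ?mulr_ge0 ?sqr_ge0// ltW.
have h8 : 0 <= x * (ln (y + x) - ln (y - x)) by rewrite mulr_ge0.
by rewrite ler_norml; lra.
Qed.

Lemma prim_cvgy x : 0 <= x -> prim x y @[y --> +oo] --> 0.
Proof.
move=> x0.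
have cb : (2 * x ^+ 2 / (y - x)) @[y --> +oo] --> (0 : R).
  rewrite -[X in _ --> X](mulr0 (2 * x ^+ 2)).
  apply: cvgM; first exact: cvg_cst.
  apply/gtr0_cvgV0.
    by near=> y; rewrite subr_gt0; near: y; apply: nbhs_pinfty_gt; exact: num_real.
  apply/cvgryPge => A; near=> y.
  by rewrite lerBrDr; near: y; apply: nbhs_pinfty_ge; exact: num_real.
apply: (@squeeze_cvgr _ _ _ _ (fun y => - (2 * x ^+ 2 / (y - x))) _ _ _ _ _ cb).
  near=> y; rewrite -ler_norml; apply: prim_bound => //.
  by near: y; apply: nbhs_pinfty_gt; exact: num_real.
by rewrite -[X in _ --> X]oppr0; exact: cvgN.
Unshelve. all: by end_near. Qed.

(** At the sign change the kernel vanishes, and only the term [x * (ln |c + x| - ln |c - x|)] of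
    [primE] is left. *)
Lemma prim_crossing x c : 0 < c -> x ^+ 2 = 2 * c ^+ 2 -> c < x ->
  0 <= prim x c <= 5 * x.
Proof.
move=> c0 xc cx; have x0 : 0 < x by lra.
have kc0 : kern x c = 0.
  by apply/eqP; rewrite eq_le kern_ge0 ?kern_le0// xc.
have cDx0 : 0 < c + x by lra.
have xBc0 : 0 < x - c by lra.
have cBx0 : c - x != 0 by rewrite subr_eq0 lt_eqF.
rewrite primE ?(gt_eqF c0) ?(gt_eqF cDx0)// kc0 mulr0 add0r distrC !gtr0_norm//.
have h2 : 0 <= ln (c + x) - ln (x - c) by rewrite subr_ge0 ler_ln ?posrE//; lra.
have h1 := ln_ratio_bound cDx0 xBc0.
(* The quotient is [2 c / (x - c)], and with [x = sqrt 2 * c] it equals [2 (sqrt 2 + 1) < 5].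
   Doubled, this is the constant 10 in the L1 norm. *)
have h3 : (c + x - (x - c)) / (x - c) <= 5 by rewrite ler_pdivrMr//; nra.
by apply/andP; split; nra.
Qed.

End kernel.

(** * Mass, tail and total integral of the kernel *)

Section kernel_integral.
Variable R : realType.
Notation mu := (@lebesgue_measure R).
Implicit Types x y c M : R.

(** Here [s] is the sign, 1 or -1, of the kernel on the interval under consideration. *)
Lemma is_derive_prim_abs (s : R) x y : y != 0 -> y + x != 0 -> y - x != 0 ->
  `|kern x y| = s * kern x y -> is_derive y 1 (s \*: prim x) `|kern x y|.
Proof.
move=> y0 yDx yBx ->.
exact: (is_deriveZ s (is_derive_prim y0 yDx yBx)).
Qed.

Lemma continuous_abs_kern x y : y != 0 -> y + x != 0 -> y - x != 0 ->
  {for y, continuous (fun y => `|kern x y|)}.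
Proof.
move=> y0 yDx yBx; apply: (@continuous_comp _ _ _ (kern x) (fun u => `|u|)).
  exact: continuous_kern.
exact: norm_continuous.
Qed.

Lemma continuous_scale_prim (s : R) x y : {for y, continuous (s \*: prim x)}.
Proof. by apply: cvgM; [exact: cvg_cst|exact: continuous_prim]. Qed.

Lemma measurable_abs_kern x (D : set R) :
  measurable_fun D (fun y => (`|kern x y|)%:E).
Proof.
apply/measurable_EFinP/measurable_funTS.
apply: (measurableT_comp (@normr_measurable R setT)) => //.
exact: measurable_kern.
Qed.

(** The half-line is cut at the sign change [c = x / sqrt 2] and at the singularity [x]; on each
    piece the absolute value has the primitive [prim x] up to a sign. On the first piece the lower
    end contributes [prim x 0 = 0]. *)
Lemma int_abs_kern_near x c : 0 < c -> x ^+ 2 = 2 * c ^+ 2 -> c < x ->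
  (\int[mu]_(y in `[0%R, c[) (`|kern x y|)%:E = (prim x c)%:E)%E.
Proof.
move=> c0 xc cx.
rewrite integral_itv_bndoo; last exact: measurable_abs_kern.
have ne y : 0 < y < c -> [/\ y != 0, y + x != 0 & y - x != 0].
  by move=> ?; split; apply/eqP; lra.
transitivity (((1 \*: prim x) c - (1 \*: prim x) 0)%:E).
  apply: (@ge0_FTC2_oo _ (fun y => `|kern x y|) (1 \*: prim x)).
  - by [].
  - by move=> y _; exact: normr_ge0.
  - move=> y yc; have [*] := ne _ yc; apply: is_derive_prim_abs => //.
    by rewrite mul1r ger0_norm// kern_ge0// xc; nra.
  - by move=> y yc; have [*] := ne _ yc; exact: continuous_abs_kern.
  - exact: continuous_scale_prim.
  - exact: continuous_scale_prim.
by rewrite /= !scale1r prim0 subr0.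
Qed.

Lemma int_abs_kern_mid x c : 0 < c -> x ^+ 2 = 2 * c ^+ 2 -> c < x ->
  (\int[mu]_(y in `[c, x[) (`|kern x y|)%:E = (prim x c - prim x x)%:E)%E.
Proof.
move=> c0 xc cx.
rewrite integral_itv_bndoo; last exact: measurable_abs_kern.
have ne y : c < y < x -> [/\ y != 0, y + x != 0 & y - x != 0].
  by move=> ?; split; apply/eqP; lra.
transitivity ((((-1) \*: prim x) x - ((-1) \*: prim x) c)%:E).
  apply: (@ge0_FTC2_oo _ (fun y => `|kern x y|) ((-1) \*: prim x)).
  - by [].
  - by move=> y _; exact: normr_ge0.
  - move=> y yc; have [*] := ne _ yc; apply: is_derive_prim_abs => //.
    by rewrite mulN1r ler0_norm// kern_le0// xc; nra.
  - by move=> y yc; have [*] := ne _ yc; exact: continuous_abs_kern.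
  - exact: continuous_scale_prim.
  - exact: continuous_scale_prim.
by rewrite /= !scaleN1r opprK addrC.
Qed.

(** The primitive vanishes at infinity. The case [M = x] is the last of the three pieces; [M > x] is
    the tail needed when the integral of [T] is truncated. *)
Lemma int_abs_kern_far x M : 0 < x -> x <= M ->
  (\int[mu]_(y in `[M, +oo[%classic) (`|kern x y|)%:E = (prim x M)%:E)%E.
Proof.
move=> x0 xM.
rewrite -integral_itv_obnd_cbnd; last exact: measurable_abs_kern.
have ne y : M < y -> [/\ y != 0, y + x != 0 & y - x != 0].
  by move=> ?; split; apply/eqP; lra.
transitivity ((0 - ((-1) \*: prim x) M)%:E).
  apply: (@ge0_FTC2_oy _ (fun y => `|kern x y|) ((-1) \*: prim x)).
  - by move=> y _; exact: normr_ge0.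
  - move=> y yc; have [*] := ne _ yc; apply: is_derive_prim_abs => //.
    by rewrite mulN1r ler0_norm// kern_le0//; nra.
  - by move=> y yc; have [*] := ne _ yc; exact: continuous_abs_kern.
  - exact: continuous_scale_prim.
  - rewrite -[X in _ --> X](mulr0 (-1)); apply: cvgM; first exact: cvg_cst.
    exact/prim_cvgy/ltW.
by rewrite /= scaleN1r sub0r opprK.
Qed.

(** The contributions [prim x x] from the two sides of the singularity cancel. *)
Lemma int_abs_kern_right x c : 0 < c -> x ^+ 2 = 2 * c ^+ 2 -> c < x ->
  (\int[mu]_(y in `[c, +oo[%classic) (`|kern x y|)%:E = (prim x c)%:E)%E.
Proof.
move=> c0 xc cx; rewrite (@itv_bndbnd_setU _ _ _ (BLeft x)) ?bnd_simp ?ltW//.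
rewrite ge0_integral_setU//=.
- by rewrite int_abs_kern_mid// int_abs_kern_far ?(lt_trans c0)// -EFinD subrK.
- exact: measurable_abs_kern.
- exact: disjoint_itv_at.
Qed.

Lemma crossing_exists x : 0 < x -> exists c, [/\ 0 < c, x ^+ 2 = 2 * c ^+ 2 & c < x].
Proof.
move=> x0; have s0 : 0 < Num.sqrt (2 : R) by rewrite sqrtr_gt0.
have s2 : Num.sqrt (2 : R) ^+ 2 = 2 by rewrite sqr_sqrtr.
have c0 : 0 < x / Num.sqrt 2 by rewrite divr_gt0.
have xc : x ^+ 2 = 2 * (x / Num.sqrt 2) ^+ 2.
  by rewrite exprMn exprVn s2 mulrC divfK.
by exists (x / Num.sqrt 2); split => //; nra.
Qed.

Lemma int_abs_kern x c : 0 < c -> x ^+ 2 = 2 * c ^+ 2 -> c < x ->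
  (\int[mu]_(y in `[0%R, +oo[%classic) (`|kern x y|)%:E = (2 * prim x c)%:E)%E.
Proof.
move=> c0 xc cx; rewrite (@itv_bndbnd_setU _ _ _ (BLeft c)) ?bnd_simp ?ltW//.
rewrite ge0_integral_setU//=.
- rewrite int_abs_kern_near// int_abs_kern_right// -EFinD; congr EFin; ring.
- exact: measurable_abs_kern.
- exact: disjoint_itv_at.
Qed.

Lemma kern0 y : kern 0 y = 0.
Proof.
have [->|y0] := eqVneq y 0; first by rewrite /kern expr0n/= invr0 mulr0 normr0 ln0.
by rewrite /kern expr0n/= sub0r mulNr divff ?expf_neq0// normrN normr1 ln1.
Qed.

Lemma kern_norm x y : kern `|x| y = kern x y.
Proof. by rewrite /kern real_normK// num_real. Qed.

Lemma integrable_kern x : mu.-integrable `[0, +oo[%classic (EFin \o kern x).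
Proof.
have [->|x0] := eqVneq x 0.
  apply: (eq_integrable _ (cst 0%E)) => //; last exact: integrable0.
  by move=> y _; rewrite /= kern0.
have := x0; rewrite -normr_gt0 => nx0.
have [c [c0 xc cx]] := crossing_exists nx0.
apply/integrableP; split.
  by apply/measurable_EFinP/measurable_funTS; exact: measurable_kern.
under eq_integral do rewrite /= -kern_norm.
by rewrite (int_abs_kern c0 xc cx) ltry.
Qed.

Lemma Rint_abs_kern_le x :
  Rintegral mu `[0, +oo[%classic (fun y => `|kern x y|) <= 10 * `|x|.
Proof.
have [->|x0] := eqVneq x 0.
  rewrite normr0 mulr0 /Rintegral; under eq_integral do rewrite kern0 normr0.
  by rewrite integral0.
have := x0; rewrite -normr_gt0 => nx0.
have [c [c0 xc cx]] := crossing_exists nx0.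
rewrite /Rintegral; under eq_integral do rewrite -kern_norm.
rewrite (int_abs_kern c0 xc cx)/=.
by have := prim_crossing c0 xc cx; lra.
Qed.

Lemma Rint_abs_kern_tail_le x M : `|x| < M ->
  Rintegral mu `[M, +oo[%classic (fun y => `|kern x y|)
    <= 2 * `|x| ^+ 2 / (M - `|x|).
Proof.
move=> xM; have [x0|x0] := eqVneq x 0.
  rewrite x0 normr0 expr0n mulr0 mul0r /Rintegral.
  under eq_integral do rewrite kern0 normr0.
  by rewrite integral0.
have := x0; rewrite -normr_gt0 => nx0.
rewrite /Rintegral; under eq_integral do rewrite -kern_norm.
rewrite (int_abs_kern_far nx0 (ltW xM))/=.
exact: le_trans (ler_norm _) (prim_bound (normr_ge0 _) xM).
Qed.

(** The positive part below the sign change [c] and the negative part above it have the same mass,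
    [prim |x| c]. *)
Lemma Rint_kern x : Rintegral mu `[0, +oo[%classic (kern x) = 0.
Proof.
have [->|x0] := eqVneq x 0.
  by rewrite /Rintegral; under eq_integral do rewrite kern0; rewrite integral0.
have := x0; rewrite -normr_gt0 => nx0.
have [c [c0 xc cx]] := crossing_exists nx0.
have -> : kern x = kern `|x| by apply/funext => y; rewrite kern_norm.
have ik := integrable_kern `|x|.
have iB : mu.-integrable `[c, +oo[%classic (EFin \o kern `|x|).
  by apply: integrableS ik => //; apply: subset_itvr; rewrite bnd_simp ltW.
rewrite (@Rintegral_split_at _ _ _ _ c)//; last by rewrite bnd_simp ltW.
have -> : Rintegral mu `[0, c[%classic (kern `|x|) = prim `|x| c.
  transitivity (Rintegral mu `[0, c[%classic (fun y => `|kern `|x| y|)).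
    apply: eq_Rintegral => y; rewrite inE/= in_itv/= => /andP[y0 yc].
    by rewrite (@ger0_norm _ (kern _ _))// kern_ge0// xc; nra.
  by rewrite /Rintegral int_abs_kern_near.
have -> : Rintegral mu `[c, +oo[%classic (kern `|x|) = - prim `|x| c.
  transitivity (Rintegral mu `[c, +oo[%classic (fun y => (-1) * `|kern `|x| y|)).
    apply: eq_Rintegral => y; rewrite inE/= in_itv/= andbT => cy.
    by rewrite mulN1r (@ler0_norm _ (kern _ _)) ?opprK// kern_le0// xc; nra.
  rewrite RintegralZl//; last exact: integrable_norm.
  by rewrite /Rintegral int_abs_kern_right// mulN1r.
by rewrite subrr.
Qed.

End kernel_integral.

(** * The operator [T]: integrability, sign, growth and stability *)

Section operators.
Variable R : realType.
Notation mu := (@lebesgue_measure R).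
Implicit Types (x y c M d h : R) (f g w : R -> R).

(** Properties of members of [Dset a] in the form the estimates use, free of [a]. The bound
    [profile_quad] keeps the integrand of [rfun], and the difference of two such integrands, at most
    1 in absolute value near 0. *)
Record profile w : Prop := Profile {
  profile_cont : continuous w ;
  profile_at0 : w 0 = 1 ;
  profile_ge0 : forall y, 0 <= w y ;
  profile_le1 : forall y, w y <= 1 ;
  profile_quad : forall y, 1 - w y <= y ^+ 2 ;
  profile_noninc : forall x y, 0 <= x -> x <= y -> w y <= w x }.

Lemma profile_dist_le1 w w' y : profile w -> profile w' -> `|w y - w' y| <= 1.
Proof.
move=> pw pw'; rewrite ler_norml.
have := profile_ge0 pw y; have := profile_ge0 pw' y.
have := profile_le1 pw y; have := profile_le1 pw' y; lra.
Qed.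

Lemma profile_dist_quad w w' y : profile w -> profile w' ->
  `|w y - w' y| <= y ^+ 2.
Proof.
move=> pw pw'; rewrite ler_norml.
have := profile_quad pw y; have := profile_quad pw' y.
have := profile_le1 pw y; have := profile_le1 pw' y; lra.
Qed.

Lemma integrable_kernM x g : continuous g -> (forall y, `|g y| <= 1) ->
  mu.-integrable `[0, +oo[%classic (EFin \o (fun y => kern x y * g y)).
Proof.
move=> cg g1; apply: le_integrable (integrable_kern x) => //.
- apply/measurable_EFinP/measurable_funTS/measurable_funM.
    exact: measurable_kern.
  exact: continuous_measurable_fun.
- by move=> y _; rewrite /= lee_fin normrM ler_piMr.
Qed.

Lemma TopE w x : Top w x =
  pi^-1 * Rintegral mu `[0, +oo[%classic (fun y => kern x y * w y).
Proof. by []. Qed.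

Lemma profile_norm_le1 w y : profile w -> `|w y| <= 1.
Proof.
by move=> pw; rewrite ger0_norm ?(profile_ge0 pw)// (profile_le1 pw).
Qed.

Lemma pi_inv_ge0 : 0 <= (pi : R)^-1.
Proof. by rewrite invr_ge0 pi_ge0. Qed.

(* The kernel changes sign once, at [c], and has zero integral, so [w] may be
   replaced by [w - w c], which has the sign of the kernel everywhere. *)
Lemma Top_ge0 w x : profile w -> 0 <= Top w x.
Proof.
move=> pw; rewrite TopE mulr_ge0 ?pi_inv_ge0//.
have [->|] := eqVneq x 0.
  by apply: Rintegral_ge0 => y _; rewrite kern0 mul0r.
rewrite -normr_gt0 => nx0.
have [c [c0 xc cx]] := crossing_exists nx0.
have ik := integrable_kern x.
have ikw : mu.-integrable `[0, +oo[%classic (EFin \o (fun y => kern x y * w y)).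
  apply: integrable_kernM => [|y]; [exact: profile_cont|exact: profile_norm_le1].
have ikc : mu.-integrable `[0, +oo[%classic (EFin \o (fun y => w c * kern x y)).
  exact: integrable_scale.
have -> : Rintegral mu `[0, +oo[%classic (fun y => kern x y * w y) =
    Rintegral mu `[0, +oo[%classic (fun y => kern x y * w y - w c * kern x y).
  by rewrite RintegralB// RintegralZl// Rint_kern mulr0 subr0.
apply: Rintegral_ge0 => y /=; rewrite in_itv/= andbT => y0.
have -> : kern x y * w y - w c * kern x y = kern x y * (w y - w c) by ring.
rewrite -kern_norm; have [cy|yc] := leP c y.
- rewrite mulr_le0//; first by rewrite kern_le0// xc; nra.
  by rewrite subr_le0 (profile_noninc pw)// ltW.
- rewrite mulr_ge0//; first by rewrite kern_ge0// xc; nra.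
  by rewrite subr_ge0 (profile_noninc pw)// ltW.
Qed.

Lemma Top_bound w x : profile w -> `|Top w x| <= pi^-1 * (10 * `|x|).
Proof.
move=> pw; rewrite TopE normrM (ger0_norm pi_inv_ge0) ler_wpM2l ?pi_inv_ge0//.
have ikw : mu.-integrable `[0, +oo[%classic (EFin \o (fun y => kern x y * w y)).
  apply: integrable_kernM => [|y]; [exact: profile_cont|exact: profile_norm_le1].
apply: le_trans (le_normr_Rintegral _ ikw) _ => //.
apply: le_trans (Rint_abs_kern_le x); apply: le_Rintegral => //.
- exact: integrable_norm ikw.
- exact: integrable_norm (integrable_kern x).
- by move=> y _; rewrite normrM ler_piMr// profile_norm_le1.
Qed.

Lemma Top_dist w w' x M d : profile w -> profile w' -> `|x| < M ->
  (forall y, 0 <= y <= M -> `|w y - w' y| <= d) ->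
  `|Top w x - Top w' x| <=
    pi^-1 * (d * (10 * `|x|) + 2 * `|x| ^+ 2 / (M - `|x|)).
Proof.
move=> pw pw' xM wd.
have M0 : 0 < M by exact: le_lt_trans xM.
have d0 : 0 <= d by rewrite (le_trans _ (wd 0 _))// lexx ltW.
have ik v : profile v ->
    mu.-integrable `[0, +oo[%classic (EFin \o (fun y => kern x y * v y)).
  move=> pv; apply: integrable_kernM => [|y].
    exact: profile_cont.
  exact: profile_norm_le1.
rewrite !TopE -mulrBr normrM (ger0_norm pi_inv_ge0) ler_wpM2l ?pi_inv_ge0//.
rewrite -RintegralB//; [|exact: ik|exact: ik].
under eq_Rintegral do rewrite -mulrBr.
have id : mu.-integrable `[0, +oo[%classic
    (EFin \o (fun y => kern x y * (w y - w' y))).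
  apply: integrable_kernM => [y|y]; last exact: profile_dist_le1.
  by apply: cvgB; exact: profile_cont.
have iad := integrable_norm id.
have iak := integrable_norm (integrable_kern x).
apply: le_trans (le_normr_Rintegral _ id) _ => //.
have sub1 : (`[0, M[%classic : set R) `<=` `[0, +oo[%classic.
  by apply: subset_itvl.
have sub2 : (`[M, +oo[%classic : set R) `<=` `[0, +oo[%classic.
  by apply: subset_itvr; rewrite bnd_simp ltW.
rewrite (@Rintegral_split_at _ _ _ _ M)//; last by rewrite bnd_simp ltW.
apply: lerD.
- apply: (@le_trans _ _ (Rintegral mu `[0, M[%classic (fun y => d * `|kern x y|))).
    apply: le_Rintegral => //.
    + exact: integrableS iad.
    + by apply: integrable_scale => //; exact: integrableS iak.
    + move=> y /=; rewrite in_itv/= => /andP[y0 yM].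
      by rewrite normrM mulrC ler_wpM2r// wd// y0 ltW.
  rewrite RintegralZl//; last exact: integrableS iak.
  rewrite ler_wpM2l// (le_trans _ (Rint_abs_kern_le x))//.
  exact: ge0_subset_Rintegral.
- apply: le_trans (Rint_abs_kern_tail_le xM).
  apply: le_Rintegral => //.
  + exact: integrableS iad.
  + exact: integrableS iak.
  + by move=> y _; rewrite normrM ler_piMr// profile_dist_le1.
Qed.

End operators.

(** * The functional [r], and Lipschitz bounds for exponentials and powers *)

Section rescaling.
Variable R : realType.
Notation mu := (@lebesgue_measure R).
Implicit Types (x y c M d h : R) (f g w : R -> R).

(** The two bounds give [|g y| / y ^+ 2 <= min (1, 1 / y ^+ 2)], which is dominated by the
    integrable function [2 / (1 + y ^+ 2)]. *)
Lemma integrable_div_sqr g : continuous g ->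
  (forall y, `|g y| <= 1) -> (forall y, `|g y| <= y ^+ 2) ->
  mu.-integrable `[0, +oo[%classic (EFin \o (fun y => g y / y ^+ 2)).
Proof.
move=> cg g1 g2.
have iq : mu.-integrable `[0, +oo[%classic (EFin \o (fun y : R => 2 * (oneDsqr y)^-1)).
  apply: integrable_scale; apply/integrableP; split.
    apply/measurable_EFinP/measurable_funTS; apply: continuous_measurable_fun.
    exact: continuous_oneDsqrV.
  under eq_integral => y _ do rewrite /= ger0_norm ?invr_ge0 ?oneDsqr_ge0//.
  by rewrite integral0y_oneDsqr ltry.
apply: le_integrable iq => //.
  apply/measurable_EFinP/measurable_funTS/measurable_funM.
    exact: continuous_measurable_fun.
  exact: measurable_inv_sqr.
move=> y _ /=; rewrite lee_fin.
have s0 : 0 < 1 + y ^+ 2 by rewrite ltr_pwDl// sqr_ge0.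
rewrite [leRHS]ger0_norm; last by rewrite mulr_ge0// invr_ge0 ltW.
have [->|y0] := eqVneq y 0; first by rewrite expr0n invr0 mulr0 normr0 mulr_ge0 ?invr_ge0 ?oneDsqr_ge0.
have y20 : 0 < y ^+ 2 by rewrite exprn_even_gt0.
rewrite normrM (@ger0_norm _ (_ ^-1)) ?invr_ge0 ?sqr_ge0//.
rewrite ler_pdivrMr// mulrAC ler_pdivlMr// /oneDsqr.
have := g1 y; have := g2 y; nra.
Qed.

Lemma integrable_rfun w : profile w ->
  mu.-integrable `[0, +oo[%classic (EFin \o (fun y => (w 0 - w y) / y ^+ 2)).
Proof.
move=> pw; have w1 y : 0 <= w 0 - w y by rewrite (profile_at0 pw) subr_ge0 (profile_le1 pw).
apply: (@integrable_div_sqr (fun y => w 0 - w y)) => y.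
- by apply: cvgB; [exact: cvg_cst|exact: profile_cont].
- by rewrite ger0_norm// (profile_at0 pw); have := profile_ge0 pw y; lra.
- by rewrite ger0_norm// (profile_at0 pw) (profile_quad pw).
Qed.

(** The integrand is nonnegative, and on [[1/2, 1[] it is at least [1 - w (1/2)], because [w] is
    non-increasing and [y ^+ 2 <= 1]. *)
Lemma rfun_gt0 w : profile w -> w 2^-1 < 1 -> 0 < rfun w.
Proof.
move=> pw wh; rewrite /rfun mulr_gt0 ?invr_gt0 ?pi_gt0//.
set q : R -> R := fun y => (w 0 - w y) / y ^+ 2.
have iq : mu.-integrable `[0, +oo[%classic (EFin \o q) by exact: integrable_rfun.
have q0 y : 0 <= q y.
  by rewrite divr_ge0 ?sqr_ge0// (profile_at0 pw) subr_ge0 (profile_le1 pw).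
have sub : (`[2^-1, 1[%classic : set R) `<=` `[0, +oo[%classic.
  by move=> y /=; rewrite !in_itv/= andbT => /andP[+ _]; apply: le_trans.
apply: (@lt_le_trans _ _ (Rintegral mu `[2^-1, 1[%classic q)); last first.
  exact: ge0_subset_Rintegral.
apply: (@lt_le_trans _ _ (Rintegral mu `[2^-1, 1[%classic (fun=> 1 - w 2^-1))).
  by rewrite Rintegral_cst_itv ?mulr_gt0//; lra.
apply: le_Rintegral => //; first exact: integrable_cst_itv.
- exact: integrableS iq.
- move=> y /=; rewrite in_itv/= => /andP[hy y1].
  have y20 : 0 < y ^+ 2 by rewrite exprn_gt0//; lra.
  have wy : w y <= w 2^-1 by apply: (profile_noninc pw) => //; lra.
  rewrite /q (profile_at0 pw) ler_pdivlMr//.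
  have y21 : y ^+ 2 <= 1 by rewrite expr_le1//; lra.
  apply: (@le_trans _ _ (1 - w 2^-1)); last by lra.
  by rewrite ler_piMr//; lra.
Qed.

(** The three summands come from [[0, h[], where the quadratic bound makes the integrand at most 1;
    from [[h, M[], where it is at most [d / h ^+ 2]; and from the tail, where it is at most
    [1 / y ^+ 2]. *)
Lemma rfun_dist w w' M d h : profile w -> profile w' -> 0 < h -> h <= M ->
  (forall y, 0 <= y <= M -> `|w y - w' y| <= d) ->
  `|rfun w - rfun w'| <= pi^-1 * (h + (d / h ^+ 2 * (M - h) + M^-1)).
Proof.
move=> pw pw' h0 hM wd.
have M0 : 0 < M by exact: lt_le_trans hM.
rewrite /rfun -mulrBr normrM (ger0_norm (pi_inv_ge0 R)) ler_wpM2l ?pi_inv_ge0//.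
rewrite -RintegralB//; [|exact: integrable_rfun|exact: integrable_rfun].
have -> : Rintegral mu `[0, +oo[%classic
    (fun y => (w 0 - w y) / y ^+ 2 - (w' 0 - w' y) / y ^+ 2) =
    Rintegral mu `[0, +oo[%classic (fun y => (w' y - w y) / y ^+ 2).
  apply: eq_Rintegral => y _.
  by rewrite (profile_at0 pw) (profile_at0 pw'); ring.
have wd' y : 0 <= y <= M -> `|w' y - w y| <= d by rewrite distrC; exact: wd.
set e : R -> R := fun y => (w' y - w y) / y ^+ 2.
have ie : mu.-integrable `[0, +oo[%classic (EFin \o e).
  apply: (@integrable_div_sqr (fun y => w' y - w y)) => y.
  - by apply: cvgB; exact: profile_cont.
  - exact: profile_dist_le1.
  - exact: profile_dist_quad.
have eE y : 0 < y -> `|e y| = `|w' y - w y| / y ^+ 2.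
  by move=> y0; rewrite normrM (@ger0_norm _ (_ ^-1))// invr_ge0 sqr_ge0.
have e1 y : 0 <= y -> `|e y| <= 1.
  rewrite le_eqVlt => /predU1P[<-|y0].
    by rewrite /e expr0n invr0 mulr0 normr0.
  rewrite eE// ler_pdivrMr ?exprn_gt0// mul1r.
  exact: profile_dist_quad.
have ia : mu.-integrable `[0, +oo[%classic (EFin \o (fun y => `|e y|)).
  exact: integrable_norm ie.
apply: le_trans (le_normr_Rintegral _ ie) _ => //.
have iS (i : interval R) : [set` i] `<=` `[0, +oo[%classic ->
  mu.-integrable [set` i] (EFin \o (fun y => `|e y|)).
  by move=> sub; exact: integrableS ia.
have subh : `[h, +oo[%classic `<=` (`[0, +oo[%classic : set R).
  by apply: subset_itvr; rewrite bnd_simp ltW.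
rewrite (@Rintegral_split_at _ _ _ _ h)//; last by rewrite bnd_simp ltW.
rewrite (@Rintegral_split_at _ _ (BLeft h) _ M)//; last exact: iS.
apply: lerD; last apply: lerD.
- apply: (@le_trans _ _ (Rintegral mu `[0, h[%classic (fun=> 1))).
    apply: le_Rintegral => //; last 2 first.
    + exact: integrable_cst_itv.
    + by move=> y /=; rewrite in_itv/= => /andP[y0 _]; exact: e1.
    + by apply: iS; exact: subset_itvl.
  by rewrite Rintegral_cst_itv ?(ltW h0)// mul1r subr0.
- apply: (@le_trans _ _ (Rintegral mu `[h, M[%classic (fun=> d / h ^+ 2))).
    apply: le_Rintegral => //; last 2 first.
    + exact: integrable_cst_itv.
    + move=> y /=; rewrite in_itv/= => /andP[hy yM].
      have y0 : 0 < y by exact: lt_le_trans hy.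
      rewrite eE//; apply: ler_pM => //; first by rewrite invr_ge0 sqr_ge0.
        by apply: wd'; rewrite !ltW.
      rewrite lef_pV2 ?posrE ?exprn_gt0//.
      by rewrite lerXn2r ?nnegrE// ltW.
    + by apply: iS; apply: subset_trans subh; exact: subset_itvl.
  by rewrite Rintegral_cst_itv.
- have iV : mu.-integrable `[M, +oo[%classic (EFin \o (fun y : R => (y ^+ 2)^-1)).
    apply/integrableP; split.
      by apply/measurable_EFinP/measurable_funTS; exact: measurable_inv_sqr.
    under eq_integral => y _ do rewrite /= ger0_norm ?invr_ge0 ?sqr_ge0//.
    by rewrite int_inv_sqr// ltry.
  apply: (@le_trans _ _ (Rintegral mu `[M, +oo[%classic (fun y => (y ^+ 2)^-1))).
    apply: le_Rintegral => //.
      by apply: iS; apply: subset_itvr; rewrite bnd_simp ltW.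
    move=> y /=; rewrite in_itv/= andbT => My.
    have y0 : 0 < y by exact: lt_le_trans My.
    rewrite eE// ler_piMl ?invr_ge0 ?sqr_ge0//.
    exact: profile_dist_le1.
  by rewrite /Rintegral int_inv_sqr.
Qed.

(** For [s <= t] the difference is [expR (- s) * (1 - expR (s - t))]; the first factor is at most 1
    and the second at most [t - s]. *)
Lemma expR_lipschitz s t : 0 <= s -> 0 <= t ->
  `|expR (- s) - expR (- t)| <= `|s - t| :> R.
Proof.
wlog st : s t / s <= t.
  move=> H s0 t0; have [st|/ltW ts] := leP s t; first exact: H.
  by rewrite distrC (distrC s); exact: H.
move=> s0 t0.
have es : 0 < expR (- s) <= 1 by rewrite expR_gt0 -expR0 ler_expR oppr_le0.
have -> : expR (- t) = expR (- s) * expR (s - t).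
  by rewrite -expRD addrA addNr add0r.
rewrite (distrC s) (@ger0_norm _ (t - s)) ?subr_ge0//.
have := expR_ge1Dx (s - t); have : expR (s - t) <= 1.
  by rewrite -expR0 ler_expR subr_le0.
by move=> h1 h2; rewrite ger0_norm; nra.
Qed.

(** For [v <= u], factoring out [u ^ p <= u] reduces the claim to [1 - z ^ p <= p (1 - z)] with
    [z = v / u]. *)
Lemma powR_lipschitz (p u v : R) : 1 < p -> 0 <= u <= 1 -> 0 <= v <= 1 ->
  `|u `^ p - v `^ p| <= p * `|u - v|.
Proof.
move=> p1; wlog vu : u v / v <= u.
  move=> H u01 v01; have [uv|/ltW uv] := leP v u; first exact: H.
  by rewrite distrC (distrC u); exact: H.
move=> /andP[u0 u1] /andP[v0 v1]; have p0 : 0 < p by lra.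
rewrite !ger0_norm ?subr_ge0//; last first.
  by rewrite ge0_ler_powR ?nnegrE// ltW.
have [u0'|un0] := eqVneq u 0.
  have -> : v = 0 by lra.
  by rewrite u0' !subrr mulr0.
have {}u0 : 0 < u by rewrite lt_neqAle eq_sym un0.
have q0 : 0 < p / (p - 1) by rewrite divr_gt0//; lra.
have z0 : 0 <= v / u by rewrite divr_ge0// ltW.
(* Young's inequality with second factor 1 is Bernoulli's inequality. *)
have pq1 : p^-1 + (p / (p - 1))^-1 = 1.
  by rewrite invf_div -[X in X + _]mul1r -mulrDl subrKC divff// gt_eqF.
have := conjugate_powR z0 ler01 p0 q0 pq1.
rewrite powR1 mulr1 invf_div mul1r => bern.
have up : u `^ p <= u by rewrite ge1r_powR ?u0 ?u1// ltW.
have vE : v `^ p = u `^ p * (v / u) `^ p.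
  by rewrite -powRM ?(ltW u0)// mulrC divfK// gt_eqF.
rewrite vE.
have b2 : 1 - (v / u) `^ p <= p * (1 - v / u).
  have : p * (v / u) <= p * ((v / u) `^ p / p + (p - 1) / p) by rewrite ler_pM2l.
  rewrite mulrDr !(mulrC p) !divfK ?gt_eqF//; lra.
have -> : p * (u - v) = u * (p * (1 - v / u)) by field; rewrite gt_eqF.
have z1 : v / u <= 1 by rewrite ler_pdivrMr// mul1r.
have zp : (v / u) `^ p <= 1.
  have -> : 1 = 1 `^ p :> R by rewrite powR1.
  by rewrite ge0_ler_powR ?nnegrE// ltW.
have pu := powR_ge0 u p.
nra.
Qed.

End rescaling.

(** * The scalar function [F_a]: range and Lipschitz bound *)

Section response.
Variable R : realType.
Implicit Types (a b s t x y : R) (w : R -> R).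

Definition response a t : R :=
  if a == 0 then expR (- t) else (Num.max (1 - a * t) 0) `^ a^-1.

Lemma RopE a w x : Rop a w x = response a (Top w x / rfun w).
Proof. by rewrite /Rop /response mulrA. Qed.

Lemma response_ge0 a t : 0 <= response a t.
Proof. by rewrite /response; case: ifP => _; rewrite ?expR_ge0 ?powR_ge0. Qed.

(* For [a < 0] the response is again a decreasing exponential, in the variable
   [ln (1 - a t) / (- a)], which is a contraction of [t >= 0]. *)
Lemma response_neg a t : a < 0 -> 0 <= t ->
  response a t = expR (- (ln (1 - a * t) / - a)) /\ 0 <= ln (1 - a * t) / - a.
Proof.
move=> a0 t0; have b1 : 1 <= 1 - a * t by nra.
split; last by rewrite divr_ge0 ?ln_ge0//; lra.
rewrite /response lt_eqF// max_l; last by lra.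
rewrite /powR gt_eqF; last by lra.
by congr expR; rewrite invrN mulrN opprK mulrC.
Qed.

Lemma response_le1 a t : 0 <= t -> response a t <= 1.
Proof.
move=> t0; have [a0|a0|a0] := ltgtP a 0.
- have [-> h] := response_neg a0 t0.
  by rewrite -[leRHS]expR0 ler_expR oppr_le0.
- rewrite /response gt_eqF//.
  apply: (@le_trans _ _ (1 `^ a^-1)); last by rewrite powR1.
  apply: ge0_ler_powR; rewrite ?nnegrE ?invr_ge0 ?ler01 ?(ltW a0)//.
    by rewrite le_max lexx orbT.
  by rewrite ge_max ler01 andbT; nra.
- by rewrite /response a0 eqxx -[leRHS]expR0 ler_expR oppr_le0.
Qed.

Lemma maxr0_lipschitz x y : `|Num.max x 0 - Num.max y 0| <= `|x - y|.
Proof.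
have := ler_norm (x - y); have := ler_norm (y - x); rewrite (distrC y x).
have := normr_ge0 (x - y).
by rewrite ler_norml; case: (leP x 0); case: (leP y 0) => *; lra.
Qed.

(** The slope [1 / (1 + b s)] at the left end is at most 1. With [b = - a] this is the contraction
    in the exponent when [a < 0]. *)
Lemma ln_lipschitz b s t : 0 < b -> 0 <= s -> s <= t ->
  0 <= (ln (1 + b * t) - ln (1 + b * s)) / b <= t - s.
Proof.
move=> b0 s0 st.
have p1 : 1 <= 1 + b * s by nra.
have p2 : 1 + b * s <= 1 + b * t by nra.
have p1' : 0 < 1 + b * s by lra.
have p2' : 0 < 1 + b * t by lra.
apply/andP; split.
  by rewrite divr_ge0 ?(ltW b0)// subr_ge0 ler_ln.
rewrite ler_pdivrMr//; apply: le_trans (ln_ratio_bound p2' p1') _.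
rewrite ler_pdivrMr//.
have : 0 <= (t - s) * b by rewrite mulr_ge0 ?subr_ge0 ?(ltW b0).
nra.
Qed.

(** For [a < 0] two contractions are composed. For [0 < a < 1] the power [1 / a > 1] is Lipschitz on
    [[0, 1]] with constant [1 / a], which cancels the factor [a] of the inner map; this is where
    [a < 1] enters. *)
Lemma response_lipschitz a s t : a < 1 -> 0 <= s -> 0 <= t ->
  `|response a s - response a t| <= `|s - t|.
Proof.
move=> a1 s0 t0; have [a0|a0|a0] := ltgtP a 0.
- have [-> hs] := response_neg a0 s0; have [-> ht] := response_neg a0 t0.
  apply: le_trans (expR_lipschitz hs ht) _.
  move=> {hs ht}; wlog st : s t s0 t0 / s <= t.
    move=> H; have [st|/ltW ts] := leP s t; first exact: H.
    by rewrite distrC (distrC s); exact: H.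
  rewrite distrC (distrC s) -mulrBl -!mulNr.
  have b0 : 0 < - a by lra.
  have /andP[h1 h2] := ln_lipschitz b0 s0 st.
  by rewrite !ger0_norm ?subr_ge0.
- have ia0 : 0 < a^-1 by rewrite invr_gt0.
  have in01 r : 0 <= r -> 0 <= Num.max (1 - a * r) 0 <= 1.
    by move=> r0; rewrite le_max lexx orbT ge_max ler01 andbT/=; nra.
  rewrite /response gt_eqF//.
  apply: le_trans (powR_lipschitz _ (in01 _ s0) (in01 _ t0)) _.
    by rewrite invf_gt1.
  rewrite ler_pdivrMl//; apply: le_trans (maxr0_lipschitz _ _) _.
  have -> : 1 - a * s - (1 - a * t) = a * (t - s) by ring.
  by rewrite normrM gtr0_norm// (distrC t).
- by rewrite /response a0 eqxx; exact: expR_lipschitz.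
Qed.

End response.

(** * From the weighted norm to closeness of [T], [r] and their quotient *)

Section continuity.
Variable R : realType.
Implicit Types (a d e h x y L M : R) (w : R -> R).

Lemma eta_gt0 a : 0 < Defs.eta a.
Proof.
by rewrite /Defs.eta invr_gt0 mulr_gt0 ?powR_gt0// exprn_gt0// ltr_pwDl.
Qed.

Lemma Dset_profile a w : w \in Dset a -> profile w.
Proof.
rewrite inE => -[cw [_ [_ [w0 [wb [wm _]]]]]].
split => // y; have [] := wb y; rewrite ?ge_max => /andP[]; lra.
Qed.

(** If [w (1/2) = 1], monotonicity and [w <= 1] force [w = 1] on [[0, 1/2]]. The left derivative at
    [1/2] would then be 0, against its bound by [- eta a < 0]. *)
Lemma Dset_half_lt1 a w : w \in Dset a -> w 2^-1 < 1.
Proof.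
move=> wD; have pw := Dset_profile wD.
rewrite lt_neqAle (profile_le1 pw) andbT; apply/eqP => w1.
move: wD; rewrite inE => -[_ [_ [_ [_ [_ [_ [_ [l [wl lneg]]]]]]]]].
have : (fun h => (w (2^-1 + h) - w 2^-1) / h) @ 0^'- --> (0 : R).
  apply: cvg_near_cst; near=> h.
  have h0 : h < 0 by near: h; exact: nbhs_left_lt.
  have h2 : - 2^-1 < h by near: h; apply: nbhs_left_gt; rewrite oppr_lt0 invr_gt0.
  have : w 2^-1 <= w (2^-1 + h) by apply: (profile_noninc pw); lra.
  have := profile_le1 pw (2^-1 + h); rewrite w1 => p1 p2.
  by rewrite (_ : w (2^-1 + h) = 1) ?subrr ?mul0r//; lra.
move=> /(cvg_unique _ wl) => l0.
by have := eta_gt0 a; move: lneg; rewrite l0//; lra.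
Unshelve. all: by end_near. Qed.

Lemma rhoE x : rho x = (Num.sqrt (1 + `|x|))^-1.
Proof. by rewrite /rho powRN powR12_sqrt// addr_ge0. Qed.

Lemma sqrt_1D_ge1 x : 1 <= Num.sqrt (1 + `|x|).
Proof. by rewrite -[leLHS]sqrtr1 ler_sqrt ?lerDl ?addr_ge0. Qed.

Lemma rho_gt0 x : 0 < rho x.
Proof. by rewrite rhoE invr_gt0 (lt_le_trans ltr01 (sqrt_1D_ge1 x)). Qed.

Lemma rho_le1 x : rho x <= 1.
Proof. by rewrite rhoE invf_le1 ?sqrt_1D_ge1// (lt_le_trans ltr01 (sqrt_1D_ge1 x)). Qed.

(** A cruder bound than the exact square root, chosen so that the constants below stay rational in
    [M]. *)
Lemma rho_lower x : 1 <= (1 + `|x|) * rho x.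
Proof.
have s1 := sqrt_1D_ge1 x.
rewrite rhoE ler_pdivlMr ?mul1r; last by rewrite (lt_le_trans ltr01 s1).
rewrite -[leRHS]sqr_sqrtr ?addr_ge0//.
by rewrite expr2 ler_peMl// (le_trans ler01 s1).
Qed.

Lemma rho_small e x : 0 < e -> e ^- 2 <= `|x| -> rho x <= e.
Proof.
move=> e0 ex; have s0 := lt_le_trans ltr01 (sqrt_1D_ge1 x).
rewrite rhoE -[leRHS]invrK lef_pV2 ?posrE ?invr_gt0//.
rewrite -[leLHS](@ger0_norm _ e^-1) ?invr_ge0 ?(ltW e0)//.
rewrite -sqrtr_sqr ler_sqrt ?addr_ge0// exprVn (le_trans ex)//.
by rewrite lerDr.
Qed.

Lemma rho_norm_dist w w' d M : profile w -> profile w' ->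
  rho_norm (fun x => w x - w' x) < d ->
  forall y, 0 <= y <= M -> `|w y - w' y| <= d * (1 + M).
Proof.
move=> pw pw' wd y /andP[y0 yM].
have : `|rho y * (w y - w' y)| <= rho_norm (fun x => w x - w' x).
  apply: ub_le_sup; last by exists y.
  (* [sup] dominates the elements only of a set that is bounded above; 1 is a bound, since
     [rho <= 1] and two profiles differ by at most 1. *)
  exists 1 => _ [x _ <-]; rewrite normrM gtr0_norm ?rho_gt0//.
  by rewrite mulr_ile1 ?profile_dist_le1 ?rho_le1// ltW// rho_gt0.
rewrite normrM gtr0_norm ?rho_gt0// => /le_lt_trans/(_ wd) h.
have := rho_lower y; rewrite (ger0_norm y0) => rl.
have r0 := rho_gt0 y; have n0 := normr_ge0 (w y - w' y).
apply: (@le_trans _ _ ((1 + y) * (rho y * `|w y - w' y|))).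
  by rewrite mulrA ler_peMl.
have := mulr_ge0 (ltW r0) n0; move: h; move: (_ * _) => z zd z0.
by nra.
Qed.

Lemma pi_inv_le1 : (pi : R)^-1 <= 1.
Proof. by rewrite invf_le1 ?pi_gt0// (le_trans _ (pi_ge2 R))// ler1n. Qed.

Lemma Top_close L e : 0 < L -> 0 < e -> exists2 d : R, 0 < d &
  forall w w', profile w -> profile w' ->
    rho_norm (fun x => w x - w' x) < d ->
    forall x, `|x| <= L -> `|Top w x - Top w' x| <= e.
Proof.
(* Chosen so that the tail term [2 L^2 / (M - L)] is [e / 2]. The radius below makes the pointwise
   distance on [[0, M]] at most [e / (20 L)], hence the main term at most [e / 2]. *)
move=> L0 e0; pose M := L + 4 * L ^+ 2 / e.
have g0 : 0 < 4 * L ^+ 2 / e by rewrite divr_gt0 ?mulr_gt0 ?exprn_gt0.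
have LM : L < M by rewrite ltrDl.
have M1 : 0 < 1 + M by rewrite addr_gt0// (lt_trans L0).
exists (e / (20 * L * (1 + M))); first by rewrite divr_gt0 ?mulr_gt0.
move=> w w' pw pw' wd x xL.
have xM : `|x| < M by exact: le_lt_trans LM.
apply: le_trans (Top_dist pw pw' xM (rho_norm_dist pw pw' wd)) _.
have n0 := normr_ge0 x.
have -> : e / (20 * L * (1 + M)) * (1 + M) = e / (20 * L).
  by field; rewrite !gt_eqF.
have h1 : e / (20 * L) * (10 * `|x|) <= e / 2.
  apply: (@le_trans _ _ (e / (20 * L) * (10 * L))).
    by rewrite ler_pM2l ?divr_gt0 ?mulr_gt0// ler_pM2l.
  rewrite le_eqVlt; apply/orP; left; apply/eqP; field; by rewrite gt_eqF.
have h2 : 2 * `|x| ^+ 2 / (M - `|x|) <= e / 2.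
  have Mx : 4 * L ^+ 2 / e <= M - `|x| by rewrite /M; lra.
  rewrite ler_pdivrMr ?subr_gt0//.
  apply: (@le_trans _ _ (e / 2 * (4 * L ^+ 2 / e))); last first.
    by rewrite ler_pM2l ?divr_gt0.
  have -> : e / 2 * (4 * L ^+ 2 / e) = 2 * L ^+ 2 by field; rewrite gt_eqF.
  nra.
have h3 : 0 <= 2 * `|x| ^+ 2 / (M - `|x|).
  by rewrite divr_ge0 ?mulr_ge0 ?sqr_ge0// subr_ge0 ltW.
have h4 : 0 <= e / (20 * L) * (10 * `|x|).
  by rewrite mulr_ge0 ?divr_ge0 ?mulr_ge0 ?(ltW L0) ?(ltW e0).
have := pi_inv_le1; have := pi_inv_ge0 R; nra.
Qed.

Lemma rfun_close e : 0 < e -> exists2 d : R, 0 < d &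
  forall w w', profile w -> profile w' ->
    rho_norm (fun x => w x - w' x) < d -> `|rfun w - rfun w'| <= e.
Proof.
(* Each of the three terms of [rfun_dist] is to be at most [e / 3]: the first is [h], the last is
   [1 / M <= e / 3], and the radius below makes the middle one [(e ^+ 2 / 9) * (3 / e)]. *)
move=> e0; pose h := e / 3; pose M := h + 3 / e.
have h0 : 0 < h by rewrite divr_gt0.
have g0 : 0 < 3 / e by rewrite divr_gt0.
have hM : h <= M by rewrite lerDl ltW.
have M0 : 0 < M by rewrite addr_gt0.
have M1 : 0 < 1 + M by rewrite addr_gt0.
exists (e ^+ 2 * h ^+ 2 / 9 / (1 + M)).
  by rewrite divr_gt0 ?mulr_gt0 ?exprn_gt0.
move=> w w' pw pw' wd.
apply: le_trans (rfun_dist pw pw' h0 hM (rho_norm_dist pw pw' wd)) _.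
have -> : e ^+ 2 * h ^+ 2 / 9 / (1 + M) * (1 + M) / h ^+ 2 * (M - h) = e / 3.
  rewrite (_ : M - h = 3 / e); last by rewrite /M addrC addKr.
  move: (h) (M) h0 M1 => h' M' h'0 M'1; field.
  by rewrite !gt_eqF.
have MV : M^-1 <= e / 3.
  by rewrite -[leRHS]invf_div lef_pV2 ?posrE// lerDr ltW.
have MV0 : 0 < M^-1 by rewrite invr_gt0.
have := pi_inv_le1; have := pi_inv_ge0 R; rewrite /h; nra.
Qed.

Lemma quotient_dist (T T' r r' e e' B : R) : 0 < r -> 0 < e' ->
  `|T - T'| <= e' -> `|r - r'| <= e' -> e' <= r / 2 -> `|T'| <= B ->
  e' * (r + 2 * B) <= e * r ^+ 2 -> `|T / r - T' / r'| <= e.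
Proof.
move=> r0 e'0 TT rr er TB ee.
have r'2 : r / 2 <= r' by have := ler_norm (r - r'); lra.
have r'0 : 0 < r' by lra.
have B0 : 0 <= B by exact: le_trans TB.
have -> : T / r - T' / r' = ((T - T') * r' + T' * (r' - r)) / (r * r').
  by field; rewrite !gt_eqF.
rewrite normrM (@ger0_norm _ (_^-1)) ?invr_ge0 ?mulr_ge0 ?(ltW r0) ?(ltW r'0)//.
rewrite ler_pdivrMr ?mulr_gt0//.
apply: le_trans (ler_normD _ _) _; rewrite !normrM (distrC r') (gtr0_norm r'0).
apply: (@le_trans _ _ (e' * r' + B * e')).
  by apply: lerD; [rewrite ler_pM2r|apply: ler_pM].
(* It remains to see [e' (r' + B) <= e r r']. Multiplied by [r], it follows because [r <= 2 r']
   gives [r (r' + B) <= r' (r + 2 B)]. *)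
have h1 : r' * (e' * (r + 2 * B)) <= r' * (e * r ^+ 2) by rewrite ler_pM2l.
have h2 : 0 <= (r' - r / 2) * (e' * B).
  by rewrite mulr_ge0 ?subr_ge0 ?mulr_ge0 ?(ltW e'0).
by rewrite -(ler_pM2l r0); lra.
Qed.

End continuity.

(** * Choice of constants and conclusion *)

Unset Implicit Arguments.

Theorem mainTheorem12 (R : realType) (a : R) (ha : a < 1) :
  forall w, w \in Dset a ->
  forall eps : R, 0 < eps -> exists delta : R, 0 < delta /\
    forall w', w' \in Dset a ->
      rho_norm (fun x => w x - w' x) < delta ->
      rho_norm (fun x => Rop a w x - Rop a w' x) < eps.
Proof.
move=> w wD eps eps0.
have pw := Dset_profile wD.
have r0 := rfun_gt0 pw (Dset_half_lt1 wD).
set r := rfun w in r0.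
(* Bounding every element by [e] bounds the supremum by [e], which is strictly below [eps]. With
   [L = e ^- 2], the weight is at most [e] once [|x| >= L]. *)
pose e := eps / 2; have e0 : 0 < e by rewrite divr_gt0.
pose L := e ^- 2; have L0 : 0 < L by rewrite invr_gt0 exprn_gt0.
pose B : R := pi^-1 * (10 * L).
have B0 : 0 <= B by rewrite !mulr_ge0 ?pi_inv_ge0 ?(ltW L0).
have rB0 : 0 < r + 2 * B by move: B0 r0; lra.
(* The two entries are the smallness conditions of [quotient_dist]; [B] bounds [T(w')] for
   [|x| <= L] uniformly in [w']. Through [r] the resulting radius depends on [w]. *)
pose e' := Num.min (r / 2) (e * r ^+ 2 / (r + 2 * B)).
have e'0 : 0 < e'.
  by rewrite lt_min (divr_gt0 r0)// divr_gt0// mulr_gt0// exprn_gt0.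
have [d1 d10 Tclose] := Top_close L0 e'0.
have [d2 d20 rclose] := rfun_close e'0.
exists (Num.min d1 d2); split; first by rewrite lt_min d10.
move=> w' w'D; rewrite lt_min => /andP[wd1 wd2].
have pw' := Dset_profile w'D.
have r'0 := rfun_gt0 pw' (Dset_half_lt1 w'D).
apply: (@le_lt_trans _ _ e); last by rewrite /e; lra.
apply: ge_sup; first by exists `|rho 0 * (Rop a w 0 - Rop a w' 0)|, 0.
move=> _ [x _ <-]; rewrite !RopE normrM (gtr0_norm (rho_gt0 x)).
have t0 : 0 <= Top w x / r by rewrite divr_ge0 ?Top_ge0 ?ltW.
have t'0 : 0 <= Top w' x / rfun w' by rewrite divr_ge0 ?Top_ge0 ?ltW.
(* For large [|x|] the two responses lie in [[0, 1]] and the weight alone suffices; for small [|x|]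
   the weight is bounded by 1 and closeness of [T / r] is used. *)
have [Lx|xL] := leP L `|x|.
  apply: le_trans (rho_small e0 Lx); rewrite ler_piMr ?(ltW (rho_gt0 x))//.
  have := response_ge0 a (Top w x / r); have := response_le1 a t0.
  have := response_ge0 a (Top w' x / rfun w'); have := response_le1 a t'0.
  by rewrite ler_norml; lra.
apply: (@le_trans _ _ `|response a (Top w x / r) - response a (Top w' x / rfun w')|).
  by rewrite ler_piMl ?rho_le1.
apply: le_trans (response_lipschitz ha t0 t'0) _.
apply: (@quotient_dist _ _ _ _ _ _ e' B r0 e'0).
- exact: Tclose pw pw' wd1 _ (ltW xL).
- exact: rclose pw pw' wd2.
- by rewrite ge_min lexx.
- apply: le_trans (Top_bound x pw') _.
  by rewrite ler_wpM2l ?pi_inv_ge0// ler_pM2l// ltW.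
- by rewrite -ler_pdivlMr// ge_min lexx orbT.
Qed.
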